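(* Let $X$ be a Peano continuum and let $\mathrm{inffree}(H_1(X))$ be the largest quotient of $H_1(X)$ having no nonzero infinitely divisible elements. If $\mathrm{card}(\mathrm{inffree}(H_1(X))) < 2^{\aleph_0}$, then $\mathrm{inffree}(H_1(X))$ is a free abelian group of finite rank.
   Context: A Peano continuum is a path connected, locally path connected, compact metrizable space. An element $a$ of an abelian group $A$ is infinitely divisible if $a$ is divisible by infinitely many positive integers $n$ (i.e. for infinitely many $n$ there is $b\in A$ with $nb=a$). For an abelian group $A$, $\mathrm{inffree}(A)=A/B$ where $B$ is the smallest subgroup such that $A/B$ has no nonzero infinitely divisible elements; concretely, $S_0$ is the set of infinitely divisible elements of $A$, $S_{\alpha+1}$ is the set of elements mapping to infinitely divisible elements of $A/\langle S_\alpha\rangle$, $S_\beta=\bigcup_{\alpha<\beta}S_\alpha$ at limits, and $B=\bigcup_\alpha\langle S_\alpha\rangle$ once the process stabilizes. Every homomorphism from $A$ to an abelian group with no nonzero infinitely divisible elements factors through $A/B$. *)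

(* Defs.v *)
From HB Require Import structures.
From mathcomp Require Import all_boot all_order all_algebra.
From mathcomp Require Import all_classical all_reals all_analysis.
Set Implicit Arguments. Unset Strict Implicit. Unset Printing Implicit Defensive.
Import Order.TTheory GRing.Theory Num.Theory numFieldTopology.Exports numFieldNormedType.Exports.
Local Open Scope classical_set_scope.
Local Open Scope ring_scope.

(* Abelian-group notions, for a quotient group  Z / N  presented inside an   *)
(* ambient abelian group M  (Z, N subgroups of M, N `<=` Z).                 *)
Section GroupNotions.
Variable M : zmodType.

Definition is_subgroup (G : set M) : Prop :=
  G 0 /\ (forall x y, G x -> G y -> G (x - y)).

Definition divisible_mod (Z C : set M) (n : nat) (z : M) : Prop :=
  exists2 w, Z w & C (w *+ n - z).

Definition infdiv_mod (Z C : set M) (z : M) : Prop :=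
  infinite_set [set n : nat | (0 < n)%N /\ divisible_mod Z C n z].

Definition no_infdiv_mod (Z C : set M) : Prop :=
  forall z, Z z -> infdiv_mod Z C z -> C z.

(* Subgroups of Z/N = subgroups C of M with N `<=` C `<=` Z.  The kernel B of
   Z/N ->> inffree(Z/N) is the smallest such C with Z/C free of nonzero
   infinitely divisible elements; we take the intersection of all of them.   *)
Definition inffree_ker (Z N : set M) : set M :=
  \bigcap_(C in [set C : set M | [/\ is_subgroup C, N `<=` C, C `<=` Z
                                   & no_infdiv_mod Z C]]) C.

Definition quot_card_lt_continuum (Z C : set M) : Prop :=
  (exists h : M -> (nat -> bool),
      forall z z', Z z -> Z z' -> (h z = h z' <-> C (z - z'))) /\
  ~ (exists g : (nat -> bool) -> M,
      (forall f, Z (g f)) /\ (forall f f', C (g f - g f') -> f = f')).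

Definition quot_free_finite_rank (Z C : set M) : Prop :=
  exists (n : nat) (e : 'I_n -> M),
    (forall i, Z (e i)) /\
    (forall z, Z z -> exists k : 'I_n -> int, C (z - \sum_(i < n) e i *~ k i)) /\
    (forall k : 'I_n -> int, C (\sum_(i < n) e i *~ k i) -> forall i, k i = 0).
End GroupNotions.

Definition I01 (R : realType) : set R := `[0, 1]%classic.

Section Topo.
Variables (R : realType) (X : topologicalType).

Definition path_in (A : set X) (x y : X) : Prop :=
  exists f : R -> X, [/\ {within @I01 R, continuous f}, f 0 = x, f 1 = y
                       & f @` @I01 R `<=` A].

Definition path_connected_set (A : set X) : Prop :=
  forall x y, A x -> A y -> path_in A x y.

Definition locally_path_connected : Prop :=
  forall (x : X) (U : set X), nbhs x U ->
    exists V : set X, [/\ open V, V x, V `<=` U & path_connected_set V].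
End Topo.

(* X is given with a (pseudo)metric inducing its topology; Hausdorff makes it
   a metric, so X is metrizable. *)
Definition peano_continuum (R : realType) (X : pseudoMetricType R) : Prop :=
  [/\ hausdorff_space X, compact [set: X],
      path_connected_set R [set: X] & locally_path_connected R X].

(* A singular 1-simplex (continuous map Delta^1 = [0,1] -> X) is encoded by   *)
(* its unique extension  f : R -> X  with  f = f \o clamp01.                  *)
(* A singular 2-simplex (continuous map                                      *)
(*   Delta^2 = {(s,t) | 0 <= s, 0 <= t, s + t <= 1} -> X,                     *)
(* vertices v0=(0,0), v1=(1,0), v2=(0,1)) is encoded by its unique extension  *)
(* g : R -> R -> X  with  g = g \o retr2, retr2 a retraction R^2 ->> Delta^2. *)
Section Singular.
Variables (R : realType) (X : topologicalType).

Definition clamp01 (u : R) : R := Num.min 1 (Num.max 0 u).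

Definition Delta2 : set (R * R) :=
  [set p | 0 <= p.1 /\ 0 <= p.2 /\ p.1 + p.2 <= 1].

Definition retr2 (p : R * R) : R * R :=
  let s := clamp01 p.1 in (s, Num.min (clamp01 p.2) (1 - s)).

Definition simplex1 (f : R -> X) : Prop :=
  {within @I01 R, continuous f} /\ (forall u, f u = f (clamp01 u)).

Definition simplex2 (g : R -> R -> X) : Prop :=
  {within Delta2, continuous (fun p : R * R => g p.1 p.2)} /\
  (forall s t, g s t = g (retr2 (s, t)).1 (retr2 (s, t)).2).

(* faces d_i (omit vertex v_i), parametrised linearly and order-preserving *)
Definition face0 (g : R -> R -> X) : R -> X :=
  fun u => let v := clamp01 u in g (1 - v) v.
Definition face1 (g : R -> R -> X) : R -> X :=
  fun u => let v := clamp01 u in g 0 v.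
Definition face2 (g : R -> R -> X) : R -> X :=
  fun u => let v := clamp01 u in g v 0.

Definition supp (T : Type) (c : T -> int) : set T := [set s | c s != 0].

Definition chain1 (c : (R -> X) -> int) : Prop :=
  finite_set (supp c) /\ supp c `<=` simplex1.
Definition chain2 (d : (R -> R -> X) -> int) : Prop :=
  finite_set (supp d) /\ supp d `<=` simplex2.

Definition ind (P : Prop) : int := (asbool P)%:R.

Definition bd1 (c : (R -> X) -> int) : X -> int :=
  fun x => \sum_(f \in supp c) c f * (ind (f 1 = x) - ind (f 0 = x)).

Definition bd2 (d : (R -> R -> X) -> int) : (R -> X) -> int :=
  fun f => \sum_(g \in supp d)
     d g * (ind (face0 g = f) - ind (face1 g = f) + ind (face2 g = f)).

Definition cycles1 : set ((R -> X) -> int) := [set c | chain1 c /\ bd1 c = 0].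
Definition boundaries1 : set ((R -> X) -> int) := [set bd2 d | d in chain2].

(* H_1(X) = cycles1 / boundaries1 ;
   inffree(H_1(X)) = cycles1 / inffree_ker cycles1 boundaries1 *)
Definition inffree_H1_ker : set ((R -> X) -> int) :=
  inffree_ker cycles1 boundaries1.
End Singular.

(* Main.v *)
(* Let A = inffree(H_1 X).  Since A has no nonzero infinitely divisible element it is torsion-free
   (in a torsion element of order n one can divide by every integer that is 1 modulo n).

   Every point x has a neighbourhood all of whose loops vanish in A.  Otherwise there are loops
   d_k at x, shrinking to x and nonzero in A; choose a_k such that 2^(a_k) does not divide d_k.
   For each 0-1 sequence s the infinitely nested word W_k = d_k^(s_k) (W_(k+1))^(2^(a_k)) is a
   continuous loop.  If W_0 has the same class for two sequences first differing at k, then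
   torsion-freeness lets one cancel down to level k, where d_k becomes divisible by 2^(a_k).
   So A would contain a copy of the Cantor set.

   By compactness loops of diameter below some fixed e vanish in A.  Join a base point to a finite
   net and the net to all points; subdividing, each path is a sum of short ones, and the class of
   a short path completed to a cycle depends only on the net points near its two ends.  Hence A is
   finitely generated, and being torsion-free it is free. *)
Require Import Defs.
From HB Require Import structures.
From mathcomp Require Import all_boot all_order all_algebra.
From mathcomp Require Import all_classical all_reals all_analysis.
From mathcomp Require Import ring lra zify.
Set Implicit Arguments. Unset Strict Implicit. Unset Printing Implicit Defensive.
Import Order.TTheory GRing.Theory Num.Theory numFieldTopology.Exports numFieldNormedType.Exports.
Local Open Scope classical_set_scope.
Local Open Scope ring_scope.

(** * Finitely generated torsion-free quotients *)

Section Subgroup.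
Variables (M : zmodType) (G : set M).
Hypothesis sgG : is_subgroup G.

Lemma subgroup0 : G 0. Proof. exact: sgG.1. Qed.

Lemma subgroupB x y : G x -> G y -> G (x - y). Proof. exact: sgG.2. Qed.

Lemma subgroupN x : G x -> G (- x).
Proof. by move=> Gx; rewrite -sub0r; apply: subgroupB => //; exact: subgroup0. Qed.

Lemma subgroupD x y : G x -> G y -> G (x + y).
Proof. by move=> Gx Gy; rewrite -[y]opprK; apply/subgroupB/subgroupN. Qed.

Lemma subgroupMn x n : G x -> G (x *+ n).
Proof.
move=> Gx; elim: n => [|n IHn]; first by rewrite mulr0n; exact: subgroup0.
by rewrite mulrS; exact: subgroupD.
Qed.

Lemma subgroupMz x (k : int) : G x -> G (x *~ k).
Proof.
by case: k => n Gx; [exact: subgroupMn|exact/subgroupN/subgroupMn].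
Qed.

Lemma subgroup_sum (I : Type) (r : seq I) (P : pred I) (F : I -> M) :
  (forall i, P i -> G (F i)) -> G (\sum_(i <- r | P i) F i).
Proof.
move=> GF; apply: (big_ind G) => //; first exact: subgroup0.
exact: subgroupD.
Qed.

End Subgroup.

Definition spans_mod (M : zmodType) (Z C : set M) n (e : 'I_n -> M) : Prop :=
  (forall i, Z (e i)) /\
  forall z, Z z -> exists k : 'I_n -> int, C (z - \sum_(i < n) e i *~ k i).

Definition torsion_free_mod (M : zmodType) (Z C : set M) : Prop :=
  forall z n, Z z -> (0 < n)%N -> C (z *+ n) -> C z.

Section FinitelyGenerated.
Variables (M : zmodType) (Z C : set M).
Hypotheses (sgZ : is_subgroup Z) (sgC : is_subgroup C).
Hypothesis tfC : torsion_free_mod Z C.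

Lemma torsion_free_modz z (k : int) : Z z -> k != 0 -> C (z *~ k) -> C z.
Proof.
move=> Zz; case: k => n k0 Cz.
  by apply: (tfC Zz (n := n)); [case: n k0 {Cz}|exact: Cz].
apply: (tfC Zz (n := n.+1)) => //.
by rewrite -[_ *+ _]opprK; exact: subgroupN.
Qed.

(** Adding [s] times [e i] to [e j] is compensated by taking [s * k j] off the coefficient of
    [e i]. *)
Lemma elementary_move n (e : 'I_n -> M) (i j : 'I_n) (s : int)
    (e' := fun l => if l == j then e j + e i *~ s else e l) (k : 'I_n -> int) :
  j != i ->
  \sum_(l < n) e l *~ k l =
  \sum_(l < n) e' l *~ (if l == i then k i - s * k j else k l).
Proof.
move=> ji; rewrite (bigD1 i) //= (bigD1 j) //= [RHS](bigD1 i) //= [in RHS](bigD1 j) //=.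
rewrite /e' !eqxx (negbTE ji) eq_sym (negbTE ji) !addrA; congr (_ + _).
  by rewrite mulrzBr mulrzDl -mulrzA [e j *~ _ + _]addrC addrA subrK.
apply: eq_bigr => l /andP[li lj].
by rewrite (negbTE li) (negbTE lj).
Qed.

Lemma spans_mod_drop n (e : 'I_n.+1 -> M) i :
  spans_mod Z C e -> C (e i) -> exists e' : 'I_n -> M, spans_mod Z C e'.
Proof.
move=> [Ze sp] Cei; exists (fun l => e (lift i l)); split=> [l|z /sp[k Ck]].
  exact: Ze.
exists (fun l => k (lift i l)).
move: Ck; rewrite (bigD1_ord i) //= opprD addrCA => Ck.
have := subgroupD sgC Ck (subgroupMz sgC (k i) Cei).
by rewrite addrAC addNr add0r.
Qed.

(* Euclid's algorithm on the coefficients of a relation. *)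
Lemma spans_mod_reduce n (e : 'I_n.+1 -> M) (k : 'I_n.+1 -> int) :
  spans_mod Z C e -> C (\sum_(i < n.+1) e i *~ k i) -> (exists i, k i != 0) ->
  exists e' : 'I_n -> M, spans_mod Z C e'.
Proof.
move: {2}(\sum_(i < n.+1) `|k i|)%N (leqnn (\sum_(i < n.+1) `|k i|)%N) => N.
elim: N e k => [|N IHN] e k kN spe Ck [i ki].
  by move: kN; rewrite leqn0 (bigD1 i) //= addn_eq0 absz_eq0 (negbTE ki).
have [[j ji kj]|none] := pselect (exists2 j, j != i & k j != 0); last first.
  (* A single nonzero coefficient makes the relation [k i] times [e i]; torsion-freeness puts [e i]
     in [C]. *)
  apply: (@spans_mod_drop n e i) => //.
  apply: (@torsion_free_modz _ (k i)) => //; first exact: spe.1.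
  move: Ck; rewrite (bigD1 i) //= big1 ?addr0 // => l li.
  have [->|kl] := eqVneq (k l) 0; first by rewrite mulr0z.
  by case: none; exists l.
wlog kij : i j ki ji kj / (`|k j| <= `|k i|)%N.
  move=> H; have [|/ltnW] := leqP `|k j| `|k i|; first exact: H.
  by apply: (H j i) => //; rewrite eq_sym.
(* With this sign [|k i - s * k j| = |k i| - |k j|], so the total size drops, while [k j] is kept
   and the relation stays nontrivial. *)
pose s := sgz (k i) * sgz (k j).
pose e' l := if l == j then e j + e i *~ s else e l.
have ke (c : 'I_n.+1 -> int) := elementary_move e s c ji.
apply: (IHN e' (fun l => if l == i then k i - s * k j else k l)).
- rewrite -ltnS; apply: leq_trans kN.
  rewrite (bigD1 i) //= [X in (_ < X)%N](bigD1 i) //= eqxx.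
  rewrite (eq_bigr (fun l => `|k l|%N)); last by move=> l /negbTE ->.
  rewrite ltn_add2r /s.
  by case: (sgzP (k i)) ki; case: (sgzP (k j)) kj kij; lia.
- split=> [l|z Zz].
    rewrite /e'; case: ifP => _; last exact: spe.1.
    apply: (subgroupD sgZ); first exact: spe.1.
    by apply: (subgroupMz sgZ); exact: spe.1.
  have [c Cc] := spe.2 z Zz.
  by exists (fun l => if l == i then c i - s * c j else c l); rewrite -ke.
- by rewrite -ke.
- by exists j; rewrite (negbTE ji).
Qed.

(** A nontrivial relation lets one pass to fewer generators; when none is left the generators form a
    basis. *)
Lemma spans_mod_free n (e : 'I_n -> M) :
  spans_mod Z C e -> quot_free_finite_rank Z C.
Proof.
elim: n e => [|n IHn] e spe.
  by exists 0%N, e; split; [exact: spe.1|split; [exact: spe.2|move=> k _ []]].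
have [[k [Ck ki]]|indep] := pselect (exists k : 'I_n.+1 -> int,
    C (\sum_(i < n.+1) e i *~ k i) /\ exists i, k i != 0).
  by have [e' /IHn] := spans_mod_reduce spe Ck ki.
exists n.+1, e; split; [exact: spe.1|split; [exact: spe.2|move=> k Ck i]].
by apply: contra_notP indep => /eqP ki; exists k; split=> //; exists i.
Qed.

End FinitelyGenerated.

(** * Quotients without infinitely divisible elements *)

Section InffreeKernel.
Variables (M : zmodType) (Z C : set M).
Hypotheses (sgZ : is_subgroup Z) (sgC : is_subgroup C).
Hypothesis ndC : no_infdiv_mod Z C.

Lemma unbounded_infinite_set (A : set nat) :
  (forall m, exists2 n, (m <= n)%N & A n) -> infinite_set A.
Proof.
move=> Aub /finite_seqP[F AF].
have [n + An] := Aub (\max_(i <- F) i).+1.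
rewrite ltnNge => /negP; apply.
have nF : n \in F by have : [set` F] n by rewrite -AF.
by rewrite (big_rem n) //= leq_max leqnn.
Qed.

(* In a quotient where [z] has order dividing [n], [z] is divisible by every integer that is 1 modulo [n]. *)
Lemma no_infdiv_torsion_free : torsion_free_mod Z C.
Proof.
move=> z n Zz n0 Cz; apply: ndC => //; apply: unbounded_infinite_set => m.
exists (m * n).+1; first nia.
split=> //; exists z => //.
by rewrite mulrS addrAC subrr add0r mulnC mulrnA; exact: subgroupMn.
Qed.

(** The powers of 2 are unbounded, so an element divisible by all of them is infinitely divisible.
    The exponents in the nested loops come from here. *)
Lemma no_infdiv_pow2 z : Z z -> ~ C z -> exists a, ~ divisible_mod Z C (2 ^ a) z.
Proof.
move=> Zz; apply: contra_notP => /forallNP all2; apply: ndC => //.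
apply: unbounded_infinite_set => m; exists (2 ^ m)%N; first exact/ltnW/ltn_expl.
by split; [rewrite expn_gt0|exact: contrapT (all2 m)].
Qed.

End InffreeKernel.

(* An intersection over the empty family is [setT]. *)
Lemma inffree_ker_spec (M : zmodType) (Z N : set M) :
  inffree_ker Z N = setT \/
  [/\ is_subgroup (inffree_ker Z N), N `<=` inffree_ker Z N,
      inffree_ker Z N `<=` Z & no_infdiv_mod Z (inffree_ker Z N)].
Proof.
set F := [set C : set M | [/\ is_subgroup C, N `<=` C, C `<=` Z & no_infdiv_mod Z C]].
have [[C0 FC0]|F0] := pselect (exists C, F C); last first.
  by left; apply/seteqP; split=> // x _ C FC; case: F0; exists C.
right; split.
- split=> [C [[] //]|x y Cx Cy C FC].
  by have [sgC _ _ _] := FC; apply: (subgroupB sgC); [exact: Cx|exact: Cy].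
- by move=> x Nx C [_ NC _ _]; exact: NC.
- by move=> x /(_ C0 FC0); have [_ _ + _] := FC0; exact.
(* Divisibility modulo the intersection gives divisibility modulo each member, with the same
   witness. *)
move=> z Zz infz C FC; have [_ _ _] := FC; apply=> //.
apply: sub_infinite_set infz => n [n0 [w Zw Cw]]; split=> //.
by exists w => //; exact: Cw.
Qed.

(** * Singular chains *)

Lemma fct_mulrzE (T : Type) (V : zmodType) (f : T -> V) (k : int) x :
  (f *~ k) x = f x *~ k.
Proof. by case: k => n; rewrite /= /intmul /= ?opprfctE natmulfctE. Qed.

Lemma fct_subE (T : Type) (V : zmodType) (f g : T -> V) x : (f - g) x = f x - g x.
Proof. by []. Qed.

Lemma fct_addE (T : Type) (V : zmodType) (f g : T -> V) x : (f + g) x = f x + g x.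
Proof. by []. Qed.

Lemma fct_oppE (T : Type) (V : zmodType) (f : T -> V) x : (- f) x = - f x.
Proof. by []. Qed.

(** Identities between integer chains are checked pointwise, in the ring [int]. *)
Ltac int_fct_ring :=
  apply/funext => ?; rewrite ?(fct_addE, fct_oppE, fct_mulrzE, natmulfctE); ring.

Section FreeChains.
Variable K : choiceType.

(** A basis element of the free abelian group on [K]; [ind] makes it agree with the terms of [bd1]
    and [bd2] by conversion. *)
Definition kron (f : K) : K -> int := fun g => ind (f = g).

Lemma kronE f g : kron f g = (f == g)%:R.
Proof. by rewrite /kron /ind; congr (nat_of_bool _)%:R; apply/asboolP/eqP. Qed.

Lemma supp_kron f : supp (kron f) = [set f].
Proof.
apply/seteqP; split=> g; rewrite /supp /= kronE; last by move->; rewrite eqxx.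
by case: (eqVneq f g) => [->|].
Qed.

Lemma sum_kron (V : zmodType) (T : K -> V) (S : seq K) f :
  uniq S -> f \in S -> T f = \sum_(g <- S) T g *~ kron f g.
Proof.
move=> uS fS; rewrite (bigD1_seq f) //= kronE eqxx mulr1z big1 ?addr0 // => g gf.
by rewrite kronE eq_sym (negbTE gf) mulr0z.
Qed.

Lemma chain_sum_kron (c : K -> int) (S : seq K) :
  uniq S -> supp c `<=` [set` S] -> c = \sum_(f <- S) kron f *~ c f.
Proof.
move=> uS cS; apply/funext => g; rewrite fct_sumE.
under eq_bigr => f _ do rewrite fct_mulrzE.
have [gS|gS] := boolP (g \in S).
  rewrite (bigD1_seq g) //= kronE eqxx -mulrzr mul1r intz big1 ?addr0 // => f fg.
  by rewrite kronE (negbTE fg) mul0rz.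
rewrite big_seq big1 => [|f fS].
  by apply: contraNP gS => /eqP; exact: cS.
by rewrite kronE (_ : f == g = false) ?mul0rz //; apply: contraNF gS => /eqP <-.
Qed.

Lemma finite_supp_seq (c : K -> int) :
  finite_set (supp c) -> exists S : seq K, uniq S /\ supp c `<=` [set` S].
Proof.
move=> /finite_seqP[S ->]; exists (undup S); split; first exact: undup_uniq.
by move=> x /=; rewrite mem_undup.
Qed.

(** The terms outside the support vanish. Allowing a larger list lets two chains be summed over the
    same one. *)
Lemma fsum_supp (c : K -> int) (F : K -> int) (S : seq K) :
  uniq S -> supp c `<=` [set` S] ->
  \sum_(f \in supp c) c f * F f = \sum_(f <- S) c f * F f.
Proof.
move=> uS cS; rewrite (fsbig_seq _ _ uS); apply: fsbig_widen => // f [_].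
by rewrite /supp /= => /negP; rewrite negbK => /eqP ->; rewrite mul0r.
Qed.

End FreeChains.

Section SingularChains.
Variables (R : realType) (X : topologicalType).
Implicit Types (f g h : R -> X) (c d : (R -> X) -> int).

Lemma bd1_sum c (S : seq (R -> X)) : uniq S -> supp c `<=` [set` S] ->
  bd1 c = \sum_(f <- S) (kron (f 1) - kron (f 0)) *~ c f.
Proof.
move=> uS cS; apply/funext => x; rewrite fct_sumE /bd1 (fsum_supp _ uS cS).
apply: eq_bigr => f _; rewrite fct_mulrzE -mulrzr intz mulrC.
by [].
Qed.

Lemma supp_chain_subset c d (S : seq (R -> X)) :
  supp c `<=` [set` S] -> supp d `<=` [set` S] -> supp (c - d) `<=` [set` S].
Proof.
move=> cS dS f; rewrite /supp /= => cdf.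
have [cf|cf] := eqVneq (c f) 0; last exact: cS.
by apply: dS; apply: contra_neq cdf => df; rewrite fct_subE cf df subrr.
Qed.

Lemma bd1B c d : chain1 c -> chain1 d -> chain1 (c - d) /\ bd1 (c - d) = bd1 c - bd1 d.
Proof.
move=> [/finite_supp_seq[S1 [_ cS]] c1] [/finite_supp_seq[S2 [_ dS]] d1].
pose S := undup (S1 ++ S2); have uS : uniq S := undup_uniq _.
have {}cS : supp c `<=` [set` S].
  by move=> f /cS /= fS; rewrite mem_undup mem_cat fS.
have {}dS : supp d `<=` [set` S].
  by move=> f /dS /= fS; rewrite mem_undup mem_cat fS orbT.
have cdS := supp_chain_subset cS dS.
split; first split.
- by apply: sub_finite_set cdS _; apply/finite_seqP; exists S.
- move=> f; rewrite /supp /= => cdf.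
  have [cf|cf] := eqVneq (c f) 0; last exact: c1.
  by apply: d1; apply: contra_neq cdf => df; rewrite fct_subE cf df subrr.
rewrite (bd1_sum uS cdS) (bd1_sum uS cS) (bd1_sum uS dS) -sumrB.
by apply: eq_bigr => f _; rewrite fct_subE mulrzBr.
Qed.

Lemma chain1_0 : chain1 (0 : (R -> X) -> int) /\ bd1 (0 : (R -> X) -> int) = 0.
Proof.
have s0 : supp (0 : (R -> X) -> int) = set0.
  by apply/seteqP; split=> f //; rewrite /supp /= eqxx.
split; first by rewrite /chain1 s0; split.
by rewrite (@bd1_sum _ [::]) ?s0 // big_nil.
Qed.

Lemma cycles1_subgroup : is_subgroup (@cycles1 R X).
Proof.
split; first exact: chain1_0.
by move=> c d [c1 bc] [d1 bd]; have [cd1 bcd] := bd1B c1 d1; split; rewrite // bcd bc bd subrr.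
Qed.

Lemma bd1D c d : chain1 c -> chain1 d -> chain1 (c + d) /\ bd1 (c + d) = bd1 c + bd1 d.
Proof.
move=> c1 d1; have [z1 bz] := chain1_0.
have [nd1 bnd] := bd1B z1 d1; have [] := bd1B c1 nd1.
by rewrite bnd bz !sub0r !opprK.
Qed.

Lemma bd1_kron f : simplex1 f ->
  chain1 (kron f) /\ bd1 (kron f) = kron (f 1) - kron (f 0).
Proof.
move=> sf; split; first by rewrite /chain1 supp_kron; split=> // g ->.
rewrite (@bd1_sum _ [:: f]) // ?supp_kron; last by move=> g ->; rewrite /= mem_head.
by rewrite big_seq1 kronE eqxx mulr1z.
Qed.

Lemma loop_cycle f : simplex1 f -> f 0 = f 1 -> cycles1 (kron f).
Proof. by move=> /bd1_kron[c1 b] f01; split; rewrite // b f01 subrr. Qed.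

(* The potential [T] is extended linearly to 0-chains and evaluated at [bd1 c = 0]. *)
Lemma cycle_sum_potential (V : zmodType) (T : X -> V) c (S : seq (R -> X)) :
  uniq S -> supp c `<=` [set` S] -> bd1 c = 0 ->
  \sum_(f <- S) (T (f 1) - T (f 0)) *~ c f = 0.
Proof.
move=> uS cS bc.
(* Expand [T] at each endpoint over the list [E] of all endpoints; after exchanging the sums, the
   coefficient of [T x] is [bd1 c x]. *)
pose E := undup ([seq f 1 | f <- S] ++ [seq f 0 | f <- S]).
have uE : uniq E := undup_uniq _.
transitivity (\sum_(f <- S) \sum_(x <- E) T x *~ ((kron (f 1) - kron (f 0)) x * c f)).
  rewrite big_seq [RHS]big_seq; apply: eq_bigr => f fS.
  have f1E : f 1 \in E by rewrite mem_undup mem_cat; apply/orP; left; apply/mapP; exists f.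
  have f0E : f 0 \in E by rewrite mem_undup mem_cat; apply/orP; right; apply/mapP; exists f.
  rewrite (sum_kron T uE f1E) (sum_kron T uE f0E) -sumrB mulrz_suml.
  by apply: eq_bigr => x _; rewrite fct_subE -mulrzBr mulrzA.
rewrite exchange_big /= big1 // => x _.
rewrite -mulrz_sumr.
have := congr1 (@^~ x) bc; rewrite (bd1_sum uS cS) fct_sumE.
rewrite (eq_bigr (fun f => (kron (f 1) - kron (f 0)) x * c f)) => [->|f _].
  by rewrite mulr0z.
by rewrite fct_mulrzE -mulrzr intz.
Qed.

Lemma bd2_kron (s : R -> R -> X) : simplex2 s ->
  boundaries1 (kron (face0 s) - kron (face1 s) + kron (face2 s)).
Proof.
move=> ss; exists (kron s).
  by rewrite /chain2 supp_kron; split=> // g ->.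
apply/funext => f; rewrite /bd2 (@fsum_supp _ _ _ [:: s]) //.
  by rewrite big_seq1 kronE eqxx mul1r.
by rewrite supp_kron => g ->; rewrite /= mem_head.
Qed.

End SingularChains.

(** * Paths modulo boundaries *)

Section Clamp.
Variable R : realType.
Implicit Types u v : R.

Lemma clamp01_bounds u : 0 <= clamp01 u <= 1.
Proof. by rewrite /clamp01 le_min ge_min le_max lexx ler01 /= lexx. Qed.

Lemma clamp01_id u : 0 <= u <= 1 -> clamp01 u = u.
Proof. by case/andP=> u0 u1; rewrite /clamp01 max_r // min_r. Qed.

Lemma clamp01K u : clamp01 (clamp01 u) = clamp01 u.
Proof. exact/clamp01_id/clamp01_bounds. Qed.

Lemma clamp01_0 : clamp01 0 = 0 :> R. Proof. by rewrite clamp01_id ?lexx ?ler01. Qed.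

Lemma clamp01_1 : clamp01 1 = 1 :> R. Proof. by rewrite clamp01_id ?lexx ?ler01. Qed.

Lemma continuous_clamp01 : continuous (@clamp01 R : R -> R).
Proof.
move=> u; apply: (@continuous_min R R (fun=> 1)); first exact: cvg_cst.
by apply: (@continuous_max R R (fun=> 0)); [exact: cvg_cst|exact: cvg_id].
Qed.

Lemma retr2_id (p : R * R) : Delta2 p -> retr2 p = p.
Proof.
case: p => s t [/= s0 [t0 st]].
have cs : clamp01 s = s by apply: clamp01_id; lra.
have ct : clamp01 t = t by apply: clamp01_id; lra.
by rewrite /retr2 /= cs ct; congr pair; apply: min_l; lra.
Qed.

Lemma retr2_Delta2 (p : R * R) : Delta2 (retr2 p).
Proof.
rewrite /Delta2 /retr2 /=.
have /andP[s0 s1] := clamp01_bounds p.1; have /andP[t0 t1] := clamp01_bounds p.2.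
split=> //; split; first by rewrite le_min t0 subr_ge0.
by rewrite -lerBrDl ge_min lexx orbT.
Qed.

Lemma continuous_retr2 : continuous (@retr2 R : R * R -> R * R).
Proof.
have c1 : continuous (fun p : R * R => clamp01 p.1 : R).
  by move=> p; apply: (@continuous_comp _ _ _ fst (@clamp01 R)); [exact: cvg_fst|exact: continuous_clamp01].
have c2 : continuous (fun p : R * R => clamp01 p.2 : R).
  by move=> p; apply: (@continuous_comp _ _ _ snd (@clamp01 R)); [exact: cvg_snd|exact: continuous_clamp01].
have cm : continuous (fun p : R * R => Num.min (clamp01 p.2) (1 - clamp01 p.1) : R).
  move=> p; apply: (@continuous_min R _ (fun p : R * R => clamp01 p.2) (fun p => 1 - clamp01 p.1)).
    exact: c2.
  by apply: cvgB; [exact: cvg_cst|exact: c1].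
by move=> p; exact: (cvg_pair (c1 p) (cm p)).
Qed.

End Clamp.

Section Paths.
Variables (R : realType) (X : topologicalType).
Implicit Types f g h : R -> X.

Lemma continuous_clamp_comp f :
  {within @I01 R, continuous f} -> continuous (fun u => f (clamp01 u)).
Proof.
move=> /subspace_continuousP cf u U fU.
have I01u : @I01 R (clamp01 u) by rewrite /I01 /= in_itv /=; exact: clamp01_bounds.
have : \forall v \near u, @I01 R (clamp01 v) -> U (f (clamp01 v)).
  exact: continuous_clamp01 (cf _ I01u _ fU).
apply: filterS => v; apply.
by rewrite /I01 /= in_itv /=; exact: clamp01_bounds.
Qed.

(** Invariance under the clamp turns continuity within the interval into continuity on the whole
    line, which is easier to compose. *)
Lemma simplex1P f :
  simplex1 f <-> continuous f /\ forall u, f u = f (clamp01 u).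
Proof.
split=> -[cf fE]; split=> //; last exact: continuous_subspaceT.
by rewrite (_ : f = fun u => f (clamp01 u)); [exact: continuous_clamp_comp|exact/funext].
Qed.

Lemma simplex1_clamp f : continuous f -> simplex1 (fun u => f (clamp01 u)).
Proof.
move=> cf; apply/simplex1P; split; last by move=> u; rewrite clamp01K.
exact/continuous_clamp_comp/continuous_subspaceT.
Qed.

Lemma path_in_simplex1 (A : set X) x y : path_in R A x y ->
  exists f, [/\ simplex1 f, f 0 = x, f 1 = y & forall u, A (f u)].
Proof.
move=> [f [cf f0 f1 fA]]; exists (fun u => f (clamp01 u)); split.
- by apply/simplex1P; split; [exact: continuous_clamp_comp|move=> u; rewrite clamp01K].
- by rewrite clamp01_0.
- by rewrite clamp01_1.
move=> u; apply: fA; exists (clamp01 u) => //.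
by rewrite /I01 /= in_itv /=; exact: clamp01_bounds.
Qed.

Definition conc f g : R -> X := fun u =>
  let v := clamp01 u in if v <= 2^-1 then f (2 * v) else g (2 * v - 1).

Definition rpath f : R -> X := fun u => f (1 - clamp01 u).

Lemma conc_clamp f g u : conc f g u = conc f g (clamp01 u).
Proof. by rewrite /conc clamp01K. Qed.

Lemma conc0 f g : conc f g 0 = f 0.
Proof. by rewrite /conc clamp01_0 mulr0 invr_ge0 ler0n. Qed.

Lemma conc1 f g : conc f g 1 = g 1.
Proof.
rewrite /conc clamp01_1 (_ : 1 <= 2^-1 = false); first by congr g; lra.
by apply/negbTE; rewrite -ltNge; lra.
Qed.

Lemma conc_range f g (A : set X) :
  (forall u, A (f u)) -> (forall u, A (g u)) -> forall u, A (conc f g u).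
Proof. by move=> fA gA u; rewrite /conc; case: ifP. Qed.

Lemma continuous_conc f g : continuous f -> continuous g -> f 1 = g 0 ->
  continuous (conc f g).
Proof.
move=> cf cg fg.
have cf2 : continuous (fun u : R => f (2 * u)).
  move=> u; apply: (@continuous_comp _ _ _ (fun u : R => 2 * u) f); last exact: cf.
  by apply: cvgM; [exact: cvg_cst|exact: cvg_id].
have cg2 : continuous (fun u : R => g (2 * u - 1)).
  move=> u; apply: (@continuous_comp _ _ _ (fun u : R => 2 * u - 1) g); last exact: cg.
  by apply: cvgB; [apply: cvgM; [exact: cvg_cst|exact: cvg_id]|exact: cvg_cst].
suff cfg : continuous (fun v : R => if v <= 2^-1 then f (2 * v) else g (2 * v - 1)).
  exact: (continuous_clamp_comp (continuous_subspaceT cfg)).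
move=> u U fU.
change (\forall v \near u, U (if v <= 2^-1 then f (2 * v) else g (2 * v - 1))).
move: fU; have [ult|ugt|->] := ltgtP u 2^-1 => fU.
- near=> v; rewrite ltW; last by near: v; exact: lt_nbhsl.
  by near: v; exact: cf2.
- near=> v; rewrite leNgt (_ : 2^-1 < v); first by near: v; exact: cg2.
  by near: v; exact: lt_nbhsr.
(* At the midpoint both formulas give [f 1 = g 0], so near it either branch lands in [U]. *)
have gU : nbhs (g (2 * 2^-1 - 1)) U.
  by rewrite divff ?subrr -?fg ?pnatr_eq0 //; rewrite divff ?pnatr_eq0 in fU.
near=> v; case: ifP => _; first by near: v; exact: cf2.
by near: v; exact: cg2.
Unshelve. all: by end_near. Qed.

Lemma simplex1_conc f g : simplex1 f -> simplex1 g -> f 1 = g 0 ->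
  simplex1 (conc f g).
Proof.
move=> /simplex1P[cf _] /simplex1P[cg _] fg; apply/simplex1P.
by split; [exact: continuous_conc|exact: conc_clamp].
Qed.

Lemma simplex1_rpath f : simplex1 f -> simplex1 (rpath f).
Proof.
move=> /simplex1P[cf _]; apply: (@simplex1_clamp (fun u => f (1 - u))) => u.
apply: (@continuous_comp _ _ _ (fun u : R => 1 - u) f); last exact: cf.
by apply: cvgB; [exact: cvg_cst|exact: cvg_id].
Qed.

Lemma rpath0 f : rpath f 0 = f 1. Proof. by rewrite /rpath clamp01_0 subr0. Qed.

Lemma rpath1 f : rpath f 1 = f 0. Proof. by rewrite /rpath clamp01_1 subrr. Qed.

Lemma simplex1_cst (x : X) : simplex1 (fun _ : R => x).
Proof. by apply/simplex1P; split=> // u; exact: cvg_cst. Qed.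

(* The linear 2-simplex in the line with vertices 0, a, b, followed by [h]. *)
Lemma boundary_linear h (a b : R) : continuous h ->
  boundaries1 (kron (fun u => let v := clamp01 u in h (a * (1 - v) + b * v))
             - kron (fun u => h (b * clamp01 u))
             + kron (fun u => h (a * clamp01 u))).
Proof.
move=> ch; pose s (x y : R) := let p := retr2 (x, y) in h (a * p.1 + b * p.2).
have ss : simplex2 s.
  split.
    apply: continuous_subspaceT => p; rewrite /s.
    apply: (@continuous_comp _ _ _ (fun p : R * R => a * (retr2 (p.1, p.2)).1 + b * (retr2 (p.1, p.2)).2) h).
      rewrite (_ : (fun p : R * R => _) = (fun p => a * (retr2 p).1 + b * (retr2 p).2)); last first.
        by apply/funext => -[].
      apply: cvgD; (apply: cvgM; first exact: cvg_cst).
        by apply: (@continuous_comp _ _ _ (@retr2 R) fst); [exact: continuous_retr2|exact: cvg_fst].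
      by apply: (@continuous_comp _ _ _ (@retr2 R) snd); [exact: continuous_retr2|exact: cvg_snd].
    exact: ch.
  by move=> x y; rewrite /s -surjective_pairing (retr2_id (retr2_Delta2 _)).
have rD x y : Delta2 (x, y) -> s x y = h (a * x + b * y).
  by move=> D; rewrite /s (retr2_id D).
have := bd2_kron ss; congr (boundaries1 (kron _ - kron _ + kron _)); apply/funext => u;
  have /andP[v0 v1] := clamp01_bounds u;
  rewrite /face0 /face1 /face2 /= rD //.
- by rewrite /Delta2 /=; lra.
- by rewrite mulr0 add0r.
- by rewrite /Delta2 /=; lra.
- by rewrite mulr0 addr0.
- by rewrite /Delta2 /=; lra.
Qed.

End Paths.

Section PathsModuloBoundaries.
Variables (R : realType) (X : topologicalType).
Implicit Types f g h : R -> X.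
Variable C : set ((R -> X) -> int).
Hypotheses (sgC : is_subgroup C) (bC : @boundaries1 R X `<=` C).

(** The three faces of a constant 2-simplex coincide, and two of them cancel in its boundary. *)
Lemma kron_cst_mod (x : X) : C (kron (fun _ : R => x)).
Proof.
have := bC (@boundary_linear R X (fun=> x) 0 0 _); rewrite subrr add0r; apply.
by move=> u; exact: cvg_cst.
Qed.

(** The linear simplex with vertices 0, 1, 0 has as faces the reverse of [f], a constant path and
    [f]. *)
Lemma kron_rpath_mod f : simplex1 f -> C (kron (rpath f) + kron f).
Proof.
move=> /simplex1P[cf fE]; have := bC (@boundary_linear R X f 1 0 cf).
rewrite (_ : (fun u => let v := _ in _) = rpath f); last first.
  by apply/funext => u /=; rewrite mul1r mul0r addr0.
rewrite (_ : (fun u => f (0 * _)) = fun=> f 0); last by apply/funext => u; rewrite mul0r.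
rewrite (_ : (fun u => f (1 * _)) = f); last by apply/funext => u; rewrite mul1r -fE.
by move=> /(subgroupD sgC)/(_ (kron_cst_mod (f 0))); rewrite addrAC subrK.
Qed.

(** The linear simplex with vertices 0, 1/2, 1, followed by [conc f g], has faces [g], [conc f g]
    and [f]. *)
Lemma kron_conc_mod f g : simplex1 f -> simplex1 g -> f 1 = g 0 ->
  C (kron (conc f g) - kron f - kron g).
Proof.
move=> /simplex1P[cf fE] /simplex1P[cg gE] fg.
have := bC (@boundary_linear R X (conc f g) 2^-1 1 (continuous_conc cf cg fg)).
rewrite (_ : (fun u => let v := _ in _) = g); last first.
  apply/funext => u /=; have /andP[v0 v1] := clamp01_bounds u.
  rewrite /conc clamp01_id; last lra.
  (* The argument is at least 1/2, so the first branch occurs only at 1/2 itself, where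
     [f 1 = g 0]. *)
  case: ifP => [vle|_]; last by rewrite [RHS]gE; congr g; lra.
  have v00 : clamp01 u = 0 by lra.
  by rewrite [RHS]gE v00 -fg; congr f; lra.
rewrite (_ : (fun u => _ (1 * _)) = conc f g); last first.
  by apply/funext => u; rewrite mul1r -conc_clamp.
rewrite (_ : (fun u => conc f g _) = f); last first.
  apply/funext => u; have /andP[v0 v1] := clamp01_bounds u.
  rewrite /conc clamp01_id; last lra.
  by rewrite ifT; [rewrite [RHS]fE; congr f; lra|lra].
move=> /(subgroupN sgC); congr C; int_fct_ring.
Qed.

End PathsModuloBoundaries.

(** * Infinitely nested loops *)

Arguments conc : simpl never.

Section BasedLoops.
Variables (R : realType) (X : topologicalType) (x : X).
Implicit Types f g : R -> X.

Definition based_loop f := [/\ simplex1 f, f 0 = x & f 1 = x].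

Lemma based_loop_cst : based_loop (fun=> x).
Proof. by split=> //; exact: simplex1_cst. Qed.

Lemma based_loop_conc f g : based_loop f -> based_loop g -> based_loop (conc f g).
Proof.
move=> [sf f0 f1] [sg g0 g1]; split; rewrite ?conc0 ?conc1 //.
by apply: simplex1_conc; rewrite // f1 g0.
Qed.

(** The loop [f] run [2 ^ a] times, built by doubling. *)
Definition pow2_path (a : nat) f := iter a (fun h => conc h h) f.

Lemma based_loop_pow2 a f : based_loop f -> based_loop (pow2_path a f).
Proof. by move=> lf; elim: a => //= a IHa; exact: based_loop_conc. Qed.

(** The time [v] does not depend on [f], so truncations of a nested word can be compared at the same
    time. *)
Lemma pow2_path_reparam a u : exists v, forall f, pow2_path a f u = f v.
Proof.
elim: a u => [|a IHa] u; first by exists u.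
have [v vP] := IHa (if clamp01 u <= 2^-1 then 2 * clamp01 u else 2 * clamp01 u - 1).
by exists v => f; rewrite -vP /= /conc; case: ifP.
Qed.

Lemma kron_pow2_mod (C : set ((R -> X) -> int)) a f :
  is_subgroup C -> @boundaries1 R X `<=` C -> based_loop f ->
  C (kron (pow2_path a f) - kron f *+ (2 ^ a)).
Proof.
move=> sgC bC lf; elim: a => [|a IHa]; first by rewrite expn0 subrr; exact: subgroup0.
have [sp p0 p1] := based_loop_pow2 a lf.
have := subgroupD sgC (kron_conc_mod sgC bC sp sp _) (subgroupMn sgC 2 IHa).
rewrite p0 p1 => /(_ erefl); congr C; rewrite expnS; int_fct_ring.
Qed.

End BasedLoops.

Section NestedLoops.
Variables (R : realType) (X : pseudoMetricType R) (x : X).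
Variables (d : nat -> R -> X) (a : nat -> nat).
Hypothesis loop_d : forall k, based_loop x (d k).
Hypothesis small_d : forall e : R, 0 < e ->
  exists N, forall k, (N <= k)%N -> forall u, ball x e (d k u).

(** The infinite word from level [k] on, truncated after [m] levels by a constant loop. *)
Fixpoint nest (m k : nat) : R -> X :=
  if m is m'.+1 then conc (d k) (pow2_path (a k) (nest m' k.+1)) else fun=> x.

Lemma based_loop_nest m k : based_loop x (nest m k).
Proof.
elim: m k => [|m IHm] k /=; first exact: based_loop_cst.
by apply: based_loop_conc => //; exact: based_loop_pow2.
Qed.

Lemma nest_step k u :
  (exists v, forall w, conc (d k) (pow2_path (a k) w) u = d k v) \/
  (exists v, forall w, conc (d k) (pow2_path (a k) w) u = w v).
Proof.
have [ule|ugt] := boolP (clamp01 u <= 2^-1).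
  by left; exists (2 * clamp01 u) => w; rewrite /conc ule.
right; have [v vP] := pow2_path_reparam X (a k) (2 * clamp01 u - 1).
by exists v => w; rewrite /conc (negbTE ugt) vP.
Qed.

(** Follow the time [u] down the levels. If it stops in some letter before depth [m], the
    truncations agree; otherwise the shorter one has reached its constant core and the longer one is
    at [x] or in a later letter. *)
Lemma nest_approx m n k u : (m <= n)%N ->
  nest m k u = nest n k u \/
  nest m k u = x /\ exists j v, (k + m <= j)%N /\ nest n k u = d j v.
Proof.
elim: n m k u => [|n IHn] [|m] k u //= mn; try by left.
  have [[v vP]|[v vP]] := nest_step k u; rewrite vP.
    by right; split=> //; exists k, v; rewrite addn0.
  have [<-|[_ [j [w [kj ->]]]]] := IHn 0%N k.+1 v isT; first by left.
  by right; split=> //; exists j, w; split=> //; lia.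
have [[v vP]|[v vP]] := nest_step k u; rewrite !vP; first by left.
have [->|[-> [j [w [kj ->]]]]] := IHn m k.+1 v mn; first by left.
by right; split=> //; exists j, w; split=> //; lia.
Qed.

(** By [nest_approx], a truncation whose value differs from [x] already has the final value. *)
Lemma nest_stabilizes k u : exists y, exists m0, forall m, (m0 <= m)%N -> nest m k u = y.
Proof.
have [[m0 m0x]|allx] := pselect (exists m, nest m k u <> x).
  exists (nest m0 k u), m0 => m m0m.
  by have [<-|[]] := nest_approx k u m0m.
exists x, 0%N => m _; apply: contrapT => mx; apply: allx; by exists m.
Qed.

Lemma nested_loops : exists W : nat -> R -> X,
  forall k, based_loop x (W k) /\ W k = conc (d k) (pow2_path (a k) (W k.+1)).
Proof.
have [W WP] := choice (fun p : nat * R => nest_stabilizes p.1 p.2).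
have {}WP k u : exists m0, forall m, (m0 <= m)%N -> nest m k u = W (k, u) := WP (k, u).
(* The bound does not depend on [u]: the truncations converge uniformly, since later letters are
   small. *)
have close m k u (e : R) : 0 < e ->
    (forall j, (m <= j)%N -> forall v, ball x e (d j v)) -> ball (nest m k u) e (W (k, u)).
  move=> e0 me; have [m0 /(_ (maxn m m0) (leq_maxr _ _)) <-] := WP k u.
  have [<-|[-> [j [v [kj ->]]]]] := nest_approx k u (leq_maxl m m0); first exact: ballxx.
  by apply: me; lia.
exists (fun k u => W (k, u)) => k; split; last first.
  apply/funext => u; have [m0 WP0] := WP k u.
  have [[v vP]|[v vP]] := nest_step k u.
    by rewrite vP -(WP0 m0.+1 (leqnSn _)) /= vP.
  have [m1 WP1] := WP k.+1 v.
  by rewrite vP -(WP0 (maxn m0 m1).+1) ?leqW ?leq_maxl //= vP (WP1 (maxn m0 m1)) ?leq_maxr.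
split; first (apply/simplex1P; split).
(* Continuity of a uniform limit, by the usual three thirds of [e]. *)
- move=> u U /nbhs_ballP[e /= e0 eU].
  have e3 : 0 < e / 3 by rewrite divr_gt0.
  have [N NP] := small_d e3.
  have [/simplex1P[cN _] _ _] := based_loop_nest N k.
  have : \forall v \near u, ball (nest N k u) (e / 3) (nest N k v).
    exact: (cN u _ (nbhsx_ballx (nest N k u) (e / 3) e3)).
  apply: filterS => v uv; apply: eU; rewrite (_ : e = e / 3 + e / 3 + e / 3); last by field.
  apply: ball_triangle (close N k v _ e3 NP).
  by apply: ball_triangle uv; apply: ball_sym; exact: close.
- move=> u; have [m0 WP0] := WP k u; have [m1 WP1] := WP k (clamp01 u).
  rewrite -(WP0 _ (leq_maxl m0 m1)) -(WP1 _ (leq_maxr m0 m1)).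
  by have [[_ +] _ _] := based_loop_nest (maxn m0 m1) k; apply.
- by have [m /(_ m (leqnn m)) <-] := WP k 0; have [] := based_loop_nest m k.
- by have [m /(_ m (leqnn m)) <-] := WP k 1; have [] := based_loop_nest m k.
Qed.

End NestedLoops.

(** * Small loops vanish in the quotient *)

Section SmallLoops.
Variables (R : realType) (X : pseudoMetricType R).
Variable C : set ((R -> X) -> int).
Hypotheses (sgC : is_subgroup C) (bC : @boundaries1 R X `<=` C).
Hypothesis ndC : no_infdiv_mod (@cycles1 R X) C.
Hypothesis smallC : ~ exists g : (nat -> bool) -> ((R -> X) -> int),
  (forall s, @cycles1 R X (g s)) /\ (forall s s', C (g s - g s') -> s = s').

Lemma based_loop_cycle x (f : R -> X) : based_loop x f -> cycles1 (kron f).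
Proof. by move=> [sf f0 f1]; apply: loop_cycle; rewrite // f0 f1. Qed.

Lemma small_based_loops_null x : exists2 e : R, 0 < e &
  forall f, based_loop x f -> (forall u, ball x e (f u)) -> C (kron f).
Proof.
apply: contrapT => none.
have /choice[d dP] : forall n : nat, exists f, [/\ based_loop x f,
    forall u, ball x (n.+1%:R^-1) (f u) & ~ C (kron f)].
  move=> n; apply: contrapT => nf; apply: none; exists n.+1%:R^-1; first by rewrite invr_gt0.
  by move=> f lf fb; apply: contrapT => Cf; apply: nf; exists f.
have Zd n : cycles1 (kron (d n)) by apply: (@based_loop_cycle x); have [] := dP n.
have /choice[a aP] : forall n, exists a, ~ divisible_mod (@cycles1 R X) C (2 ^ a) (kron (d n)).
  by move=> n; apply: no_infdiv_pow2 => //; have [] := dP n.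
(* The sequence [s] selects which letters occur; an omitted letter becomes a constant loop, so the
   shape of the word is the same for all [s]. *)
have nested (s : nat -> bool) : exists W : nat -> R -> X, forall k, based_loop x (W k) /\
    W k = conc (if s k then d k else fun=> x) (pow2_path (a k) (W k.+1)).
  apply: nested_loops => [k|e e0].
    by case: (s k); [have [] := dP k|exact: based_loop_cst].
  have [N Ne] : exists N, N.+1%:R^-1 < e.
    exists (Num.truncn e^-1); rewrite invf_plt ?posrE //.
    exact: truncnS_gt.
  exists N => k Nk u; case: (s k); last exact: ballxx.
  have [_ + _] := dP k; move=> /(_ u); apply: le_ball; apply: le_trans (ltW Ne).
  by rewrite lef_pV2 ?posrE // ler_nat.
have {nested} [W WP] := choice nested.
have lW s k : based_loop x (W s k) := (WP s k).1.
have ZW s k : cycles1 (kron (W s k)) by exact: based_loop_cycle (lW s k).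
have recW s k : C (kron (W s k) - (if s k then kron (d k) else 0)
                   - kron (W s k.+1) *+ 2 ^ a k).
  have [[sd d0 d1] _ _] := dP k; have lp := based_loop_pow2 (a k) (lW s k.+1).
  have [sp p0 p1] := lp; rewrite (WP s k).2.
  have l1 : based_loop x (if s k then d k else fun=> x).
    by case: (s k) => //; exact: based_loop_cst.
  have [s1 _ l11] := l1.
  have := subgroupD sgC (kron_conc_mod sgC bC s1 sp (etrans l11 (esym p0)))
    (kron_pow2_mod (a k) sgC bC (lW s k.+1)).
  (* The constant loop standing for an omitted letter is a nonzero chain, removed modulo [C]. *)
  case: (s k) {l1 s1 l11} => H; last have {H} := subgroupD sgC H (kron_cst_mod bC x).
    by move: H; congr C; int_fct_ring.
  congr C; rewrite subr0; int_fct_ring.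
apply: smallC; exists (fun s => kron (W s 0%N)); split=> // s s' C0.
have step k : C (kron (W s k) - kron (W s' k)) ->
    s k = s' k /\ C (kron (W s k.+1) - kron (W s' k.+1)).
  move=> Ck.
  have key : C ((if s k then kron (d k) else 0) - (if s' k then kron (d k) else 0)
      + (kron (W s k.+1) - kron (W s' k.+1)) *+ 2 ^ a k).
    have := subgroupB sgC Ck (subgroupB sgC (recW s k) (recW s' k)).
    congr C; int_fct_ring.
  have ZB := subgroupB (cycles1_subgroup R X) (ZW s k.+1) (ZW s' k.+1).
  have tf := no_infdiv_torsion_free sgC ndC.
  have tf0 : C (0 + (kron (W s k.+1) - kron (W s' k.+1)) *+ 2 ^ a k) ->
      C (kron (W s k.+1) - kron (W s' k.+1)).
    by rewrite add0r; apply: tf ZB _; rewrite expn_gt0.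
  (* Equal digits cancel, and torsion-freeness removes the factor [2 ^ a k]. Different digits would
     make [kron (d k)] divisible by [2 ^ a k], against the choice of [a]. *)
  case: (s k) (s' k) key => [] [] key.
  - by split=> //; apply: tf0; rewrite -[0](subrr (kron (d k))).
  - exfalso; apply: (aP k).
    exists (kron (W s' k.+1) - kron (W s k.+1)).
      by apply: (subgroupB (cycles1_subgroup R X)); exact: ZW.
    by move: (subgroupN sgC key); congr C; rewrite subr0; int_fct_ring.
  - exfalso; apply: (aP k).
    exists (kron (W s k.+1) - kron (W s' k.+1)) => //.
    by move: key; congr C; rewrite sub0r; int_fct_ring.
  - by split=> //; apply: tf0; rewrite -[X in X + _](subrr 0).
have Ck k : C (kron (W s k) - kron (W s' k)) by elim: k => // k /step[].
by apply/funext => k; have [] := step k (Ck k).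
Qed.

Definition loops_null (A : set X) :=
  forall f, simplex1 f -> f 0 = f 1 -> (forall u, A (f u)) -> C (kron f).

(** The path [f] followed by the reverse of [g] is a loop in [A]. *)
Lemma parallel_paths_mod A f g : loops_null A -> simplex1 f -> simplex1 g ->
  f 0 = g 0 -> f 1 = g 1 -> (forall u, A (f u)) -> (forall u, A (g u)) ->
  C (kron f - kron g).
Proof.
move=> nA sf sg fg0 fg1 fA gA; have sr := simplex1_rpath sg.
have frg : f 1 = rpath g 0 by rewrite rpath0.
have Cl : C (kron (conc f (rpath g))).
  apply: nA; first exact: simplex1_conc.
    by rewrite conc0 conc1 rpath1.
  by apply: conc_range => // u; exact: gA.
have := subgroupB sgC (subgroupB sgC Cl (kron_conc_mod sgC bC sf sr frg)) (kron_rpath_mod sgC bC sg).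
congr C; int_fct_ring.
Qed.

(** Passes from loops at [x] to loops with any base point: conjugating by a path from [x] inside [V]
    stays in the ball and does not change the class. *)
Lemma loops_null_nbhs (x : X) : locally_path_connected R X ->
  exists2 V, nbhs x V & loops_null V.
Proof.
move=> lpc; have [e e0 eP] := small_based_loops_null x.
have [V [oV Vx Ve pV]] := lpc x _ (nbhsx_ballx x e e0).
exists V; first exact: open_nbhs_nbhs.
move=> f sf f01 fV.
have [p [sp p0 p1 pinV]] := path_in_simplex1 (pV _ _ Vx (fV 0)).
have pf : p 1 = f 0 by [].
have s1 := simplex1_conc sp sf pf; have sr := simplex1_rpath sp.
have e1 : conc p f 1 = rpath p 0 by rewrite conc1 rpath0 -f01.
have Cl : C (kron (conc (conc p f) (rpath p))).
  apply: eP; first by split; [exact: simplex1_conc|rewrite !conc0|rewrite conc1 rpath1].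
  move=> u; apply: Ve; apply: conc_range => [|v]; first exact: conc_range.
  exact: pinV.
have := subgroupB sgC (subgroupB sgC (subgroupB sgC Cl (kron_conc_mod sgC bC s1 sr e1))
  (kron_conc_mod sgC bC sp sf pf)) (kron_rpath_mod sgC bC sp).
congr C; int_fct_ring.
Qed.

End SmallLoops.

(** * Finite generation *)

Section Uniformity.
Variables (R : realType) (X : pseudoMetricType R).

(** The Lebesgue number lemma for a hereditary property. It serves uniform continuity, short
    connecting paths and null loops. *)
Lemma compact_uniform_ball (Y : pseudoMetricType R) (K : set Y) (P : set Y -> Prop) :
  compact K -> (forall A B : set Y, A `<=` B -> P B -> P A) ->
  (forall x, K x -> exists2 V, nbhs x V & P V) ->
  exists2 e : R, 0 < e & forall x, K x -> P (ball x e).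
Proof.
move=> /compact_near_coveringP cK Pmono Ploc.
have : \forall e \near (0 : R)^'+, K `<=` (fun x => P (ball x e)).
  apply: cK => x Kx; have [V /nbhs_ballP[r /= r0 rV] PV] := Ploc x Kx.
  have r2 : 0 < r / 2 by rewrite divr_gt0.
  exists (ball x (r / 2), [set e | e < r / 2]) => /=.
    by split; [exact: nbhsx_ballx|exact: nbhs_right_lt].
  move=> [y e] /= [xy er]; apply: Pmono PV => z yz; apply: rV.
  rewrite [r]splitr; apply: ball_triangle xy _.
  exact: le_ball (ltW er) _ yz.
move=> H; have [e [e0 eP]] := filter_ex (@filterI _ _ _ _ _ (nbhs_right_gt (0 : R)) H).
by exists e.
Qed.

Lemma compact_finite_net (e : R) : 0 < e -> compact [set: X] ->
  exists S : seq X, forall p, exists2 x, x \in S & ball x e p.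
Proof.
move=> e0 /compact_near_coveringP cX.
(* Finite lists directed by inclusion: near each point, every list containing that point is a
   net. *)
pose F := filter_from [set: seq X] (fun S0 => [set S : seq X | {subset S0 <= S}]).
have FF : Filter F.
  apply: filter_from_filter; first by exists [::].
  move=> S T _ _; exists (S ++ T) => // U STU.
  by split=> x xS; apply: STU; rewrite mem_cat xS ?orbT.
have [|S0 _ /(_ S0)] := cX _ F (fun S p => exists2 x, x \in S & ball x e p) FF.
  move=> x _; exists (ball x e, [set S : seq X | x \in S]).
    split; first exact: nbhsx_ballx.
    by exists [:: x] => // S; apply; exact: mem_head.
  by move=> [y S] /= [xy xS]; exists x.
by move=> H; exists S0 => p; exact: H.
Qed.

(** The modulus is a power of 1/2, so that [n] bounds the number of halvings needed to reach short
    paths. *)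
Lemma simplex1_unif_continuous (f : R -> X) (e : R) : simplex1 f -> 0 < e ->
  exists n : nat, forall u v, 0 <= u <= 1 -> 0 <= v <= 1 ->
    `|u - v| <= 2^-1 ^+ n -> ball (f u) e (f v).
Proof.
move=> /simplex1P[cf fE] e0.
have [|A B AB PB u v Au Av|u _|r r0 rP] := @compact_uniform_ball R (@I01 R)
  (fun A => forall u v, A u -> A v -> ball (f u) e (f v)).
- exact: segment_compact.
- by apply: PB; exact: AB.
- have e2 : 0 < e / 2 by rewrite divr_gt0.
  exists (f @^-1` ball (f u) (e / 2)); first exact: (cf u _ (nbhsx_ballx (f u) _ e2)).
  move=> v w /= uv uw; rewrite [e]splitr; apply: ball_triangle uw; exact: ball_sym.
have [n _ /(_ n (leqnn n)) nr] := near_infty_natSinv_expn_lt (PosNum r0).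
exists n => u v u01 v01 uv; apply: (rP u); [by []|exact: ballxx|].
by apply: le_lt_trans uv _; rewrite exprVn -div1r.
Qed.

End Uniformity.

Section Spanned.
Variables (M : zmodType) (Z C : set M) (T : finType) (e : T -> M).
Hypothesis sgC : is_subgroup C.

Definition spanned_mod : set M :=
  [set z | exists k : T -> int, C (z - \sum_t e t *~ k t)].

Lemma spanned_mod_sub z : C z -> spanned_mod z.
Proof. by move=> Cz; exists (fun=> 0); rewrite big1 ?subr0. Qed.

Lemma spanned_mod_gen t : spanned_mod (e t).
Proof.
exists (fun s => (s == t)%:R); rewrite (bigD1 t) //= eqxx big1 => [|s /negbTE ->] //.
by rewrite addr0 subrr; exact: subgroup0.
Qed.

Lemma spanned_mod_subgroup : is_subgroup spanned_mod.
Proof.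
split=> [|x y [k Ck] [l Cl]]; first by apply: spanned_mod_sub; exact: subgroup0.
exists (fun t => k t - l t); have := subgroupB sgC Ck Cl.
have -> : \sum_t e t *~ (k t - l t) = \sum_t e t *~ k t - \sum_t e t *~ l t.
  by rewrite -sumrB; apply: eq_bigr => t _; exact: mulrzBr.
by congr C; rewrite !opprB addrACA [RHS]addrACA [- y + _]addrC.
Qed.

Lemma spanned_mod_spans : (forall t, Z (e t)) -> Z `<=` spanned_mod ->
  exists n (e' : 'I_n -> M), spans_mod Z C e'.
Proof.
move=> Ze Zsp; exists #|T|, (fun i => e (enum_val i)); split=> // z /Zsp[k Ck].
exists (fun i => k (enum_val i)); move: Ck.
by rewrite (reindex _ (onW_bij _ (@enum_val_bij T))).
Qed.

End Spanned.

Section FinitelyManyCycles.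
Variables (R : realType) (X : pseudoMetricType R).
Variable C : set ((R -> X) -> int).
Hypotheses (sgC : is_subgroup C) (bC : @boundaries1 R X `<=` C).

Lemma simplex1_halves (f : R -> X) : simplex1 f ->
  exists g h, [/\ simplex1 g, simplex1 h, g 1 = h 0, f = conc g h &
    forall u, 0 <= u <= 1 -> g u = f (u / 2) /\ h u = f ((u + 1) / 2)].
Proof.
move=> /simplex1P[cf fE].
exists (fun u => f (clamp01 u / 2)), (fun u => f ((clamp01 u + 1) / 2)); split.
- apply: (@simplex1_clamp R X (fun u => f (u / 2))) => u.
  apply: (@continuous_comp _ _ _ (fun u : R => u / 2) f); last exact: cf.
  by apply: cvgM; [exact: cvg_id|exact: cvg_cst].
- apply: (@simplex1_clamp R X (fun u => f ((u + 1) / 2))) => u.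
  apply: (@continuous_comp _ _ _ (fun u : R => (u + 1) / 2) f); last exact: cf.
  by apply: cvgM; [apply: cvgD; [exact: cvg_id|exact: cvg_cst]|exact: cvg_cst].
- by rewrite clamp01_0 clamp01_1 add0r.
- apply/funext => u; have /andP[v0 v1] := clamp01_bounds u; rewrite /conc fE.
  case: (leP (clamp01 u) 2^-1) => ule; congr f.
    by rewrite [clamp01 (2 * _)]clamp01_id; lra.
  by rewrite [clamp01 (_ - 1)]clamp01_id; lra.
by move=> u u01; rewrite clamp01_id.
Qed.

Hypotheses (cX : compact [set: X]) (pX : path_connected_set R [set: X]).
Hypothesis lpcX : locally_path_connected R X.
Hypothesis nullX : forall x : X, exists2 V, nbhs x V & loops_null C V.

(** Local path connectedness made uniform by compactness. *)
Lemma uniform_short_paths (e : R) : 0 < e -> exists2 d : R, 0 < d &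
  forall p q : X, ball p d q -> exists s : R -> X,
    [/\ simplex1 s, s 0 = p, s 1 = q & forall u, ball p e (s u)].
Proof.
move=> e0.
have [|A B AB PB p q Ap Aq|x _|d d0 dP] := @compact_uniform_ball R X setT
  (fun A => forall p q, A p -> A q -> exists s : R -> X,
     [/\ simplex1 s, s 0 = p, s 1 = q & forall u, ball p e (s u)]).
- exact: cX.
- by apply: PB; exact: AB.
- have e2 : 0 < e / 2 by rewrite divr_gt0.
  have [V [oV Vx Ve pV]] := lpcX (nbhsx_ballx x _ e2).
  exists V => [|p q Vp Vq]; first exact: open_nbhs_nbhs.
  have [s [ss s0 s1 sV]] := path_in_simplex1 (pV _ _ Vp Vq).
  exists s; split=> // u; rewrite [e]splitr; apply: ball_triangle (Ve _ (sV u)).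
  by apply: ball_sym; exact: Ve.
by exists d => // p q pq; apply: (dP p) => //; exact: ballxx.
Qed.

Lemma cycles1_finitely_generated (x0 : X) : exists n (e : 'I_n -> ((R -> X) -> int)),
  spans_mod (@cycles1 R X) C e.
Proof.
have [A B AB nB f sf f01 fA|x _|e e0 nullE] :=
    @compact_uniform_ball R X setT (loops_null C) cX.
- by apply: nB => // u; exact: AB.
- exact: nullX.
(* A quarter, because the end of [hex f] below is reached from its first net point in four steps of
   this size. *)
have e4 : 0 < e / 4 by rewrite divr_gt0.
have [d d0 pathd] := uniform_short_paths e4.
have [S netS] := compact_finite_net d0 cX.
pose pt (i : 'I_(size S)) := nth x0 S i.
have /choice[idx idxP] : forall p, exists i, ball (pt i) d p.
  move=> p; have [x xS xp] := netS p.
  by move: (xS); rewrite -index_mem => xi; exists (Ordinal xi); rewrite /pt nth_index.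
have /choice[s sP] : forall p, exists s : R -> X,
    [/\ simplex1 s, s 0 = pt (idx p), s 1 = p & forall u, ball (pt (idx p)) (e / 4) (s u)].
  by move=> p; exact: pathd.
have /choice[q qP] : forall i, exists q : R -> X, [/\ simplex1 q, q 0 = x0 & q 1 = pt i].
  by move=> i; have [q [sq q0 q1 _]] := path_in_simplex1 (pX (x := x0) (y := pt i) I I); exists q.
(* [T p] is a chain from [x0] to [p] through the net point chosen for [p]; [L f] uses it to close
   [f] up to a cycle. *)
pose T p := kron (q (idx p)) + kron (s p).
pose L (f : R -> X) := kron f + T (f 0) - T (f 1).
have bdT p : chain1 (T p) /\ bd1 (T p) = kron p - kron x0.
  have [sq q0 q1] := qP (idx p); have [ss s0 s1 _] := sP p.
  have [cq bq] := bd1_kron sq; have [cs bs] := bd1_kron ss.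
  have [cT bT] := bd1D cq cs; split=> //.
  by rewrite /T bT bq bs q0 q1 s0 s1; int_fct_ring.
have ZL f : simplex1 f -> cycles1 (L f).
  move=> /bd1_kron[cf bf]; have [cT0 bT0] := bdT (f 0); have [cT1 bT1] := bdT (f 1).
  have [cD bD] := bd1D cf cT0; have [cB bB] := bd1B cD cT1.
  by split=> //; rewrite /L bB bD bf bT0 bT1; int_fct_ring.
pose short (f : R -> X) := simplex1 f /\ forall u, ball (f 0) (e / 4) (f u).
(* A short path prolonged to one between net points, still inside a ball of radius [e]. *)
pose hex f := conc (conc (s (f 0)) f) (rpath (s (f 1))).
have hexP f : short f -> [/\ simplex1 (hex f), hex f 0 = pt (idx (f 0)),
    hex f 1 = pt (idx (f 1)), forall u, ball (pt (idx (f 0))) e (hex f u) &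
    C (kron (hex f) - (kron (s (f 0)) + kron f - kron (s (f 1))))].
  move=> [sf shf]; have [s0 s00 s01 s0b] := sP (f 0); have [s1 s10 s11 s1b] := sP (f 1).
  have sr := simplex1_rpath s1; have sc := simplex1_conc s0 sf s01.
  have j2 : conc (s (f 0)) f 1 = rpath (s (f 1)) 0 by rewrite conc1 rpath0 s11.
  split.
  - exact: simplex1_conc.
  - by rewrite /hex !conc0.
  - by rewrite /hex conc1 rpath1.
  - have b0 : ball (pt (idx (f 0))) (e / 4) (f 0) by rewrite -[X in ball _ _ X]s01.
    have b1 : ball (pt (idx (f 1))) (e / 4) (f 1) by rewrite -[X in ball _ _ X]s11.
    have b2 u : ball (pt (idx (f 0))) (e / 4 + e / 4) (f u) by exact: ball_triangle b0 (shf u).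
    apply: conc_range => [u|u]; last first.
      rewrite (_ : e = e / 4 + e / 4 + e / 4 + e / 4); last by field.
      apply: ball_triangle (s1b _); apply: ball_triangle (b2 1) _; exact: ball_sym.
    apply: conc_range u => u; first by apply: le_ball (s0b u); lra.
    by apply: le_ball (b2 u); lra.
  have := subgroupD sgC (subgroupD sgC (kron_conc_mod sgC bC sc sr j2)
    (kron_conc_mod sgC bC s0 sf s01)) (kron_rpath_mod sgC bC s1).
  congr C; int_fct_ring.
have /choice[gen genP] : forall t : 'I_(size S) * 'I_(size S), exists m,
    cycles1 m /\ forall f, short f -> (idx (f 0), idx (f 1)) = t -> C (L f - m).
  move=> t; have [[f0 [sh0 t0]]|none] :=
      pselect (exists f0, short f0 /\ (idx (f0 0), idx (f0 1)) = t); last first.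
    (* Default generator for a pair of net points that no short path joins. *)
    exists 0; split; first exact: subgroup0 (cycles1_subgroup R X).
    by move=> f shf ft; case: none; exists f.
  exists (L f0); split=> [|f shf]; first by case: sh0 => /ZL.
  rewrite -t0 => -[i0 i1].
  have [sh hx0 hx1 hxb Ch] := hexP f shf; have [sh' hx0' hx1' hxb' Ch'] := hexP f0 sh0.
  rewrite i0 in hx0 hxb; rewrite i1 in hx1.
  (* Both prolonged paths have the same ends and lie in the same null ball; the [q] terms of [L]
     depend on the net points only and cancel. *)
  have := parallel_paths_mod sgC bC (nullE (pt (idx (f0 0))) I) sh sh'
    (etrans hx0 (esym hx0')) (etrans hx1 (esym hx1')) hxb hxb'.
  move=> /(subgroupB sgC)/(_ (subgroupB sgC Ch Ch')).
  rewrite /L /T i0 i1; congr C; int_fct_ring.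
apply: (@spanned_mod_spans _ (@cycles1 R X) C _ gen); first by move=> t; have [] := genP t.
have sgS := spanned_mod_subgroup gen sgC.
have spS f : short f -> spanned_mod C gen (L f).
  move=> shf; have [_ /(_ f shf erefl) Cf] := genP (idx (f 0), idx (f 1)).
  have := subgroupD sgS (spanned_mod_sub gen Cf) (spanned_mod_gen gen sgC (idx (f 0), idx (f 1))).
  by rewrite subrK.
have spL f : simplex1 f -> spanned_mod C gen (L f).
  move=> sf; have [n] := simplex1_unif_continuous sf e4.
  (* At [n = 0] the modulus is 1 and [f] is short. Otherwise halve [f]: modulo [C], [L] is additive,
     as the terms [T] at the midpoint cancel. *)
  elim: n f sf => [|n IHn] f sf fn.
    apply: spS; split=> // u; have [_ fE] := sf; rewrite (fE u).
    apply: fn; [by rewrite lexx ler01|exact: clamp01_bounds|rewrite sub0r normrN].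
    by have /andP[v0 v1] := clamp01_bounds u; rewrite ger0_norm.
  have [g [h [sg sh gh fE ghP]]] := simplex1_halves sf.
  have pow : 2^-1 ^+ n.+1 = 2^-1 ^+ n / 2 :> R by rewrite exprSr.
  have spg : spanned_mod C gen (L g).
    apply: IHn => // u v u01 v01 uv; rewrite (ghP u u01).1 (ghP v v01).1.
    apply: fn; [lra|lra|].
    by rewrite -mulrBl normrM (@ger0_norm _ 2^-1) ?invr_ge0 // pow ler_wpM2r ?invr_ge0.
  have sph : spanned_mod C gen (L h).
    apply: IHn => // u v u01 v01 uv; rewrite (ghP u u01).2 (ghP v v01).2.
    apply: fn; [lra|lra|].
    rewrite -mulrBl normrM (@ger0_norm _ 2^-1) ?invr_ge0 // pow ler_wpM2r ?invr_ge0 //.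
    by rewrite opprD addrACA subrr addr0.
  have := subgroupD sgS (subgroupD sgS spg sph)
    (spanned_mod_sub gen (kron_conc_mod sgC bC sg sh gh)).
  rewrite -fE; congr (spanned_mod C gen _).
  by rewrite /L fE conc0 conc1 -gh; int_fct_ring.
move=> z [[/finite_supp_seq[F [uF zF]] z1] bz].
(* The terms [T] contribute nothing in total: [T] is a potential and [z] a cycle. *)
have <- : \sum_(f <- F) L f *~ z f = z.
  rewrite [RHS](chain_sum_kron uF zF); apply/funext => g; rewrite !fct_sumE.
  have := congr1 (@^~ g) (cycle_sum_potential T uF zF bz); rewrite fct_sumE => E.
  rewrite -[RHS]subr0 -[X in _ = _ - X]E -sumrB; apply: eq_bigr => f _.
  by rewrite !fct_mulrzE /L fct_subE fct_addE fct_subE -mulrzBl; congr (_ *~ _); ring.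
apply: (subgroup_sum sgS) => f _; have [->|zf] := eqVneq (z f) 0.
  by rewrite mulr0z; exact: subgroup0.
by apply: (subgroupMz sgS); apply: spL; exact: z1.
Qed.

End FinitelyManyCycles.

Theorem theorem3p6 (R : realType) (X : pseudoMetricType R) :
  peano_continuum X ->
  quot_card_lt_continuum (@cycles1 R X) (@inffree_H1_ker R X) ->
  quot_free_finite_rank (@cycles1 R X) (@inffree_H1_ker R X).
Proof.
move=> [_ cX pX lpcX] [_ smallC].
have [CT|[sgC bC _ ndC]] := inffree_ker_spec (@cycles1 R X) (@boundaries1 R X).
  (* A kernel equal to [setT] gives the zero quotient, of rank 0. *)
  exists 0%N, (fun=> 0); rewrite /inffree_H1_ker CT.
  by split; [case|split=> [z _|k _ []] //; exists (fun=> 0)].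
rewrite -[inffree_ker _ _]/(@inffree_H1_ker R X) in sgC bC ndC.
have sgZ := cycles1_subgroup R X; have tf := no_infdiv_torsion_free sgC ndC.
have [n [e spe]] : exists n (e : 'I_n -> ((R -> X) -> int)),
    spans_mod (@cycles1 R X) (@inffree_H1_ker R X) e.
  have [[x0 _]|noX] := pselect (exists x : X, True).
    apply: cycles1_finitely_generated x0 => // x; exact: loops_null_nbhs.
  (* Over an empty space there are no maps [R -> X], so the only chain is 0. *)
  exists 0%N, (fun=> 0); split=> [[] //|z _]; exists (fun=> 0).
  rewrite big_ord0 subr0 (_ : z = 0); first exact: subgroup0.
  by apply/funext => f; case: noX; exists (f 0).
exact: spans_mod_free sgZ sgC tf _ _ spe.
Qed.
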